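(* Let $K$ be a field complete with respect to a discrete valuation $v$ of residue characteristic $p$, normalized so that $v(p)=1$. Let $\ell\ge2$, $c\in\overline K$, $f(z)=z^\ell-c$ separable, $\alpha\in K$, and for $n\ge0$ let $K_n=K(\{\beta\in\overline K:f^n(\beta)=\alpha\})$, $K_\infty=\bigcup_{n\ge0}K_n$. Let $\nu_\infty=-\frac{\ell}{\ell-1}v(\ell)$. If $v(c)<\nu_\infty$, then $K_\infty/K$ is a finite extension.
   Context: $f^n$ is the $n$-fold composition of $f$. *)

(* Defs.v *)
From HB Require Import structures.
From mathcomp Require Import all_boot all_order all_algebra all_field.
From mathcomp Require Import classical_sets constructive_ereal.

Set Implicit Arguments.
Unset Strict Implicit.
Unset Printing Implicit Defensive.

Import Order.TTheory GRing.Theory Num.Theory.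
Local Open Scope ring_scope.
Local Open Scope classical_set_scope.

(* Valuations are written additively and take their values in
   \bar rat = rat + {+oo, -oo}, the value -oo being excluded. Rational values
   lose no generality here: a value group that is infinite cyclic and contains
   v(p) = 1 is (1/e)Z for some e > 0, and its extension to an algebraic closure
   is contained in Q. *)
Definition valuation (F : fieldType) (v : F -> \bar rat) : Prop :=
  [/\ forall x, v x <> -oo%E,
      forall x, v x = +oo%E <-> x = 0,
      forall x y, v (x * y)%R = (v x + v y)%E
    & forall x y, (Order.min (v x) (v y) <= v (x + y)%R)%E].

(* The group of values of v at nonzero arguments is infinite cyclic, with positive generator g. *)
Definition discrete_valuation (F : fieldType) (v : F -> \bar rat) : Prop :=
  valuation v /\
  exists2 g : rat, 0 < g &
    forall q : rat, (exists2 x, x != 0 & v x = q%:E) <->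
                    (exists m : int, q = m%:~R * g).

(* n vanishes in the residue field {v >= 0} / {v > 0} iff v(n) > 0. *)
Definition residue_characteristic (F : fieldType) (v : F -> \bar rat)
    (p : nat) : Prop :=
  forall n : nat, (0 < v n%:R%R)%E <-> (p %| n)%N.

Definition valuation_cauchy (F : fieldType) (v : F -> \bar rat)
    (u : nat -> F) : Prop :=
  forall M : rat, exists N : nat, forall i j : nat,
    (N <= i)%N -> (N <= j)%N -> (M%:E <= v (u i - u j)%R)%E.

Definition valuation_cvg (F : fieldType) (v : F -> \bar rat)
    (u : nat -> F) (l : F) : Prop :=
  forall M : rat, exists N : nat, forall i : nat,
    (N <= i)%N -> (M%:E <= v (u i - l)%R)%E.

Definition valuation_complete (F : fieldType) (v : F -> \bar rat) : Prop :=
  forall u : nat -> F, valuation_cauchy v u -> exists l, valuation_cvg v u l.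

(* K(S): the smallest subfield of L containing iota(K) and S. *)
Definition adjoin (K L : fieldType) (iota : {rmorphism K -> L}) (S : set L) :
    set L :=
  smallest (fun E : set L => divring_closed (mem E)) (range iota `|` S).

Definition backward_orbit (L : fieldType) (f : {poly L}) (a : L) (n : nat) :
    set L :=
  [set b | iter n (horner f) b = a].

Definition preimage_field (K L : fieldType) (iota : {rmorphism K -> L})
    (f : {poly L}) (alpha : K) (n : nat) : set L :=
  adjoin iota (backward_orbit f (iota alpha) n).

Definition preimage_field_infty (K L : fieldType) (iota : {rmorphism K -> L})
    (f : {poly L}) (alpha : K) : set L :=
  \bigcup_n preimage_field iota f alpha n.

(* E is spanned over K by finitely many of its elements. *)
Definition finite_extension (K L : fieldType) (iota : {rmorphism K -> L})
    (E : set L) : Prop :=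
  exists (d : nat) (b : 'I_d -> L),
    (forall i, E (b i)) /\
    (forall x, E x -> exists a : 'I_d -> K, x = \sum_i iota (a i) * b i).

Definition nu_infty (F : fieldType) (v : F -> \bar rat) (l : nat) : \bar rat :=
  ((- (l%:R / (l%:R - 1)))%R%:E * v l%:R%R)%E.

(* Main.v *)
Require Import Defs.
From HB Require Import structures.
From mathcomp Require Import all_boot all_order all_algebra all_field.
From mathcomp Require Import boolp classical_sets constructive_ereal.
From mathcomp Require Import zify ring lra.

Set Implicit Arguments.
Unset Strict Implicit.
Unset Printing Implicit Defensive.

Import Order.TTheory GRing.Theory Num.Theory.
Local Open Scope ring_scope.

(* Write v(c) = -l s. Far enough in the backward orbit of alpha every element has valuation -s, and
   there f' has valuation -delta, where delta = (l - 1) s - v(l) > 0 by hypothesis, so that f is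
   expanding. The identity f'(u) / (f(u) - y) = \sum_(f(z) = y) 1 / (u - z) then provides, for each u,
   a preimage z of y with v(u - z) >= v(f(u) - y) + delta. Iterating, every element of f^-(n+1)(alpha)
   is arbitrarily close, for n large, to an element of f^-n(alpha). If b in f^-(n+1)(alpha) is close to
   x in f^-n(alpha), Newton's iteration for z^l = f(b) + c started at x converges to b and stays in any
   field containing c and f^-n(alpha); a finite extension of K is closed, so it contains b. Hence the
   backward orbit stops generating new elements after finitely many levels. *)

(** * Ultrametric estimates for a valuation with rational values *)

Section Valuation.

Variables (L : fieldType) (v : L -> \bar rat).
Hypothesis v_valuation : valuation v.

(* The value [+oo] at [0] is sent to the junk value [0], so [fval] is only meaningful on nonzero arguments. *)
Definition fval (x : L) : rat := fine (v x).

(** Stated with [v] and not with [fval], so that 0 satisfies every lower bound. *)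
Definition val_ge (q : rat) (x : L) : Prop := (q%:E <= v x)%E.

Lemma fvalE x : x != 0 -> v x = (fval x)%:E.
Proof.
case: v_valuation => vN v0 _ _ x0; rewrite /fval fineK // fin_numE.
apply/andP; split; first by apply/eqP/vN.
by apply/eqP => /v0 /eqP; rewrite (negPf x0).
Qed.

Lemma val_geP q x : x != 0 -> val_ge q x <-> q <= fval x.
Proof. by move=> x0; rewrite /val_ge fvalE // lee_fin. Qed.

Lemma val_ge0 q : val_ge q 0.
Proof.
by case: v_valuation => _ v0 _ _; rewrite /val_ge ((v0 0).2 erefl) leey.
Qed.

Lemma val_ge_val x : val_ge (fval x) x.
Proof. by have [->|/(val_geP (fval x))->] := eqVneq x 0; first exact: val_ge0. Qed.

Lemma val_ge_le q r x : q <= r -> val_ge r x -> val_ge q x.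
Proof. by move=> qr; apply: le_trans; rewrite lee_fin. Qed.

Lemma val_geD q x y : val_ge q x -> val_ge q y -> val_ge q (x + y).
Proof.
case: v_valuation => _ _ _ vD hx hy; apply: le_trans (vD x y).
by rewrite le_min; apply/andP.
Qed.

Lemma fvalM x y : x != 0 -> y != 0 -> fval (x * y) = fval x + fval y.
Proof.
case: v_valuation => _ _ vM _ x0 y0; apply: EFin_inj.
by rewrite -fvalE ?mulf_neq0 // vM !fvalE.
Qed.

Lemma val_geM q r x y : val_ge q x -> val_ge r y -> val_ge (q + r) (x * y).
Proof.
have [->|x0] := eqVneq x 0; first by rewrite mul0r => _ _; apply: val_ge0.
have [->|y0] := eqVneq y 0; first by rewrite mulr0 => _ _; apply: val_ge0.
by rewrite !val_geP ?mulf_neq0 // fvalM //; apply: lerD.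
Qed.

Lemma fval1 : fval 1 = 0.
Proof.
by apply: (addrI (fval 1)); rewrite -fvalM ?oner_eq0 // mulr1 addr0.
Qed.

Lemma fvalN1 : fval (-1) = 0.
Proof.
have n1 : -1 != 0 :> L by rewrite oppr_eq0 oner_eq0.
have := fvalM n1 n1; rewrite mulrNN mulr1 fval1; lra.
Qed.

Lemma val_geN q x : val_ge q x -> val_ge q (- x).
Proof.
move=> hx; rewrite -mulN1r -[q]add0r -fvalN1.
by apply: val_geM => //; apply: val_ge_val.
Qed.

Lemma val_geB q x y : val_ge q x -> val_ge q y -> val_ge q (x - y).
Proof. by move=> hx /val_geN; apply: val_geD. Qed.

Lemma fvalX x n : x != 0 -> fval (x ^+ n) = fval x *+ n.
Proof.
move=> x0; elim: n => [|n IHn]; first by rewrite expr0 fval1.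
by rewrite exprS fvalM ?expf_neq0 // IHn mulrS.
Qed.

Lemma val_geX q x n : val_ge q x -> val_ge (q *+ n) (x ^+ n).
Proof.
move=> hx; elim: n => [|n IHn]; first by rewrite mulr0n -fval1; apply: val_ge_val.
by rewrite exprS mulrS; apply: val_geM.
Qed.

Lemma fvalV x : x != 0 -> fval x^-1 = - fval x.
Proof.
move=> x0; have := fvalM x0 (invr_neq0 x0); rewrite divff // fval1; lra.
Qed.

Lemma val_ge_nat n : val_ge 0 n%:R.
Proof.
elim: n => [|n IHn]; first exact: val_ge0.
rewrite mulrS; apply: val_geD => //.
by rewrite -fval1; apply: val_ge_val.
Qed.

Lemma val_geMn q x n : val_ge q x -> val_ge q (x *+ n).
Proof.
move=> hx; rewrite -mulr_natr -[q]addr0.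
exact: val_geM hx (val_ge_nat n).
Qed.

Lemma val_add_eq q x y : x != 0 -> val_ge q y -> fval x < q ->
  x + y != 0 /\ fval (x + y) = fval x.
Proof.
move=> x0 hy xq.
have xy0 : x + y != 0.
  apply/eqP => xy; have /val_geN := hy.
  by rewrite -[- y]add0r -xy addrK val_geP //; apply/negP; rewrite -ltNge.
split=> //; apply: le_anti; apply/andP; split.
  rewrite leNgt; apply/negP => lt_x.
  have : val_ge (Num.min (fval (x + y)) q) (x + y - y).
    apply: val_geB; first by rewrite val_geP // ge_min lexx.
    by apply: val_ge_le hy; rewrite ge_min lexx orbT.
  by rewrite addrK val_geP // leNgt lt_min lt_x xq.
apply/val_geP => //; apply: val_geD; first exact: val_ge_val.
by apply: val_ge_le hy; apply: ltW.
Qed.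

(* This is the bound [P'(u) / P(u) = \sum_z 1 / (u - z)] read through the valuation. *)
Lemma val_ge_deriv_prod (s : seq L) u : s != [::] ->
    (forall z, z \in s -> u != z) ->
  let P := \prod_(z <- s) ('X - z%:P) in
  exists2 z, z \in s & val_ge (fval P.[u] - fval (u - z)) P^`().[u].
Proof.
elim: s => // z s IHs _ hs /=.
have uz : u - z != 0 by rewrite subr_eq0 hs // mem_head.
have hs' y : y \in s -> u != y by move=> ys; apply: hs; rewrite in_cons ys orbT.
have [->|s0] := eqVneq s [::].
  exists z; first exact: mem_head.
  rewrite big_seq1 derivB derivX derivC subr0 !hornerE subrr.
  by rewrite -fval1; apply: val_ge_val.
have /= [y ys] := IHs s0 hs'; rewrite big_cons.
set Q := \prod_(j <- s) _ => hQ.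
have Q0 : Q.[u] != 0.
  apply/negP => /= h; have : root Q u by [].
  by rewrite root_prod_XsubC => /hs' /eqP.
have -> : (('X - z%:P) * Q)^`().[u] = Q.[u] + (u - z) * Q^`().[u].
  by rewrite derivM derivB derivX derivC subr0 mul1r !hornerE.
have -> : fval (('X - z%:P) * Q).[u] = fval (u - z) + fval Q.[u].
  by rewrite !hornerE fvalM.
have hzQ := val_geM (val_ge_val (u - z)) hQ.
(* Of [z] and [y], the root closer to [u] is kept: it bounds both summands of the derivative. *)
have [le_zy|lt_yz] := leP (fval (u - y)) (fval (u - z)).
  exists z; first exact: mem_head.
  apply: val_geD; first by rewrite addrAC subrr add0r; apply: val_ge_val.
  by apply: val_ge_le hzQ; lra.
exists y; first by rewrite in_cons ys orbT.
apply: val_geD; last by rewrite -addrA.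
by rewrite val_geP //; lra.
Qed.

(** The remainders satisfy [R_(n+1) = (x + h) R_n + n x^(n-1) h^2], and both terms respect the
    bound. The term [t *+ 2] makes Newton's iteration quadratic. *)
Lemma val_ge_Taylor2 q t x h n : 0 <= t -> val_ge q x -> val_ge (q + t) h ->
  val_ge (q *+ n + t *+ 2) ((x + h) ^+ n - x ^+ n - x ^+ n.-1 * h *+ n).
Proof.
move=> t0 hx hh; elim: n => [|n IHn].
  rewrite !expr0 subrr mulr0n subr0; exact: val_ge0.
have -> : (x + h) ^+ n.+1 - x ^+ n.+1 - x ^+ n.+1.-1 * h *+ n.+1 =
    (x + h) * ((x + h) ^+ n - x ^+ n - x ^+ n.-1 * h *+ n)
    + x ^+ n.-1 * h ^+ 2 *+ n.
  (* The factor [n] absorbs the case [n = 0], where [x * x ^+ n.-1] differs from [x ^+ n]. *)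
  have xE : x * x ^+ n.-1 * n%:R = x ^+ n * n%:R.
    by case: (n) => [|m]; rewrite ?mulr0 //= exprS.
  rewrite !exprS expr0 mulr1 /= -[_ * h *+ n.+1]mulr_natr -natr1.
  rewrite -[_ * h *+ n]mulr_natr -[_ * (h * h) *+ n]mulr_natr.
  move: ((x + h) ^+ n) (x ^+ n) (x ^+ n.-1) (n%:R : L) xE => A B C m xE.
  apply/eqP; rewrite -subr_eq0; apply/eqP.
  transitivity (h * (x * C * m - B * m)); first by ring.
  by rewrite xE subrr mulr0.
apply: val_geD.
  have -> : q *+ n.+1 + t *+ 2 = q + (q *+ n + t *+ 2) by rewrite mulrS -addrA.
  apply: val_geM => //; apply: val_geD => //.
  by apply: val_ge_le hh; lra.
case: n {IHn} => [|n] /=; first by rewrite mulr0n; apply: val_ge0.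
apply: val_geMn.
have -> : q *+ n.+2 + t *+ 2 = q *+ n + (q + t) *+ 2.
  by rewrite -addn2 mulrnDr mulrnDl -addrA.
by apply: val_geM; apply: val_geX.
Qed.

End Valuation.

(** * Finite-dimensional subspaces: generators and closedness *)

Section Span.

Variables (K L : fieldType) (phi : {rmorphism K -> L}).

(** Recursion over the generators fits induction on the list; [span_sumE] gives back linear
    combinations. *)
Fixpoint span (s : seq L) (x : L) : Prop :=
  if s is b :: s' then exists a, span s' (x - phi a * b) else x = 0.

Lemma span0 s : span s 0.
Proof. by elim: s => //= b s IHs; exists 0; rewrite rmorph0 mul0r subr0. Qed.

Lemma spanD s x y : span s x -> span s y -> span s (x + y).
Proof.
elim: s x y => [x y -> ->|b s IHs x y /= [a hx] [a' hy]]; first by rewrite /= addr0.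
exists (a + a'); rewrite rmorphD mulrDl opprD addrACA; exact: IHs.
Qed.

Lemma spanZ s a x : span s x -> span s (phi a * x).
Proof.
elim: s x => [x ->|b s IHs x /= [a' hx]]; first by rewrite /= mulr0.
exists (a * a'); rewrite rmorphM -mulrA -mulrBr; exact: IHs.
Qed.

Lemma spanN s x : span s x -> span s (- x).
Proof. by move=> /(spanZ (-1)); rewrite rmorphN1 mulN1r. Qed.

Lemma span_cons b s x : span s x -> span (b :: s) x.
Proof. by move=> hx; exists 0; rewrite rmorph0 mul0r subr0. Qed.

Lemma span_mem s b : b \in s -> span s b.
Proof.
elim: s => // c s IHs; rewrite in_cons => /orP[/eqP ->|/IHs]; last exact: span_cons.
by exists 1; rewrite rmorph1 mul1r subrr; apply: span0.
Qed.

Lemma span_sub s t x : (forall b, b \in s -> span t b) -> span s x -> span t x.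
Proof.
elim: s x => [x _ ->|b s IHs x hst /= [a hx]]; first exact: span0.
rewrite -[x](subrK (phi a * b)); apply: spanD.
  by apply: IHs hx => c cs; apply: hst; rewrite in_cons cs orbT.
by apply: spanZ; apply: hst; rewrite mem_head.
Qed.

Lemma span_sumE s x : span s x ->
  exists a : 'I_(size s) -> K, x = \sum_i phi (a i) * s`_i.
Proof.
elim: s x => [x ->|b s IHs x /= [a0 /IHs[a ax]]].
  by exists (fun=> 0); rewrite big_ord0.
exists (fun i => oapp a a0 (unlift ord0 i)).
rewrite big_ord_recl unlift_none /=.
apply/eqP; rewrite addrC -subr_eq ax; apply/eqP.
by apply: eq_bigr => i _; rewrite liftK.
Qed.

(** Gaussian elimination works for an arbitrary subset [S]: a [w] in [S] that involves [b] serves to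
    remove [b] from the other elements. This provides generators inside [S], as [finite_extension]
    demands. *)
Lemma finite_span_sub (S : L -> Prop) s : (forall x, S x -> span s x) ->
  exists t, (forall b, b \in t -> S b) /\ (forall x, S x -> span t x).
Proof.
elim: s S => [|b s IHs] S hS.
  by exists [::]; split=> // x /hS.
have [hs|] := pselect (forall x, S x -> span s x); first exact: IHs.
move=> /existsNP[w /not_implyP[Sw nw]].
have [a0 ha0] := hS w Sw.
have a0N0 : phi a0 != 0.
  by apply/eqP => a00; apply: nw; rewrite a00 mul0r subr0 in ha0.
(* The remainders in [span s] of elements of [S] modulo [w]; those in the list [t] found for [S']
   are then traded for elements of [S] they come from. *)
pose S' u := span s u /\ exists2 x, S x & exists a, x = phi a * w + u.
have [t [tS' S't]] := IHs S' (fun u => @proj1 _ _).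
have [t' [t'S tt']] : exists t', (forall b, b \in t' -> S b) /\
    forall u, u \in t -> span (w :: t') u.
  elim: t tS' {S't} => [|u t IHt] tS'; first by exists [::].
  have [|t' [t'S tt']] := IHt; first by move=> c ct; apply: tS'; rewrite in_cons ct orbT.
  have [_ [x Sx [a xE]]] := tS' u (mem_head _ _).
  exists (x :: t'); split=> [c|c].
    by rewrite in_cons => /orP[/eqP ->|/t'S].
  rewrite in_cons => /orP[/eqP ->|/tt' [a' ha']]; last by exists a'; apply: span_cons.
  exists (- a); rewrite rmorphN mulNr opprK addrC -xE.
  by apply: span_mem; rewrite mem_head.
exists (w :: t'); split=> [c|x Sx].
  by rewrite in_cons => /orP[/eqP ->|/t'S].
have [a ha] := hS x Sx.
have S'u : S' (x - phi (a / a0) * w).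
  split; last by exists x => //; exists (a / a0); rewrite addrC subrK.
  have -> : x - phi (a / a0) * w =
     (x - phi a * b) - phi (a / a0) * (w - phi a0 * b).
    by rewrite fmorph_div; field.
  by apply: spanD => //; apply/spanN/spanZ.
rewrite -[x](subrK (phi (a / a0) * w)); apply: spanD.
  exact: span_sub (S't _ S'u).
by apply: spanZ; apply: span_mem; rewrite mem_head.
Qed.

(** Induction on the list. If [b] is outside [span s], it keeps a positive distance from it, so the
    coefficients of [b] in approximations of [x] form a Cauchy sequence; with their limit [a'],
    induction applies to [x - phi a' * b]. *)
Lemma span_closed (v : K -> \bar rat) (w : L -> \bar rat) :
    valuation w -> (forall a, w (phi a) = v a) -> valuation_complete v ->
  forall s x, (forall M, exists2 y, span s y & val_ge w M (x - y)) -> span s x.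
Proof.
move=> w_val w_ext v_compl; elim=> [|b s IHs] x hx.
  apply: contrapT => /eqP x0; have [y -> ] := hx (fval w x + 1).
  by rewrite subr0 val_geP // gerDl; apply/negP; rewrite -ltNge.
have [sb|nsb] := pselect (span s b).
  apply: span_cons; apply: IHs => M; have [y hy My] := hx M; exists y => //.
  by apply: span_sub hy => c; rewrite in_cons => /orP[/eqP ->|/span_mem].
(* Without such an [M0], [b] would be a limit of [span s], hence a member by induction. *)
have [M0 hM0] : exists M0, forall u, span s u -> ~ val_ge w M0 (b - u).
  apply: contrapT => /forallNP h; apply: nsb; apply: IHs => M.
  have /existsNP[u /not_implyP[su /contrapT bu]] := h M.
  by exists u.
have /choice[a ha] (n : nat) : exists a,
    exists2 u, span s u & val_ge w n%:R (x - phi a * b - u).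
  have [y [a sy] My] := hx n%:R; exists a, (y - phi a * b) => //.
  by have -> : x - phi a * b - (y - phi a * b) = x - y by ring.
(* If [a i - a j] had too small a valuation, dividing by it would give an approximation of [b] in
   [span s] that contradicts [M0]. *)
have a_near (N i j : nat) : (N <= i)%N -> (N <= j)%N ->
    val_ge w (N%:R - M0) (phi (a i - a j)).
  move=> Ni Nj; have [->|aij] := eqVneq (a i) (a j).
    by rewrite subrr rmorph0; apply: val_ge0.
  set d := phi _; have d0 : d != 0 by rewrite fmorph_eq0 subr_eq0.
  have [ui sui hui] := ha i; have [uj suj huj] := ha j.
  rewrite val_geP // leNgt; apply/negP => lt_d.
  apply: (hM0 (phi (a i - a j)^-1 * (uj - ui))).
    by apply/spanZ/spanD => //; apply: spanN.
  have -> : b - phi (a i - a j)^-1 * (uj - ui) =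
      d^-1 * ((x - phi (a j) * b - uj) - (x - phi (a i) * b - ui)).
    have dE : d = phi (a i) - phi (a j) by rewrite /d rmorphB.
    by rewrite fmorphV -/d; apply: (mulfI d0); rewrite mulrBr !mulVKf // dE; ring.
  apply: (@val_ge_le _ _ _ (- fval w d + N%:R)); first by lra.
  apply: val_geM => //; first by rewrite -fvalV //; apply: val_ge_val.
  apply: val_geB => //; [apply: val_ge_le huj | apply: val_ge_le hui];
    by rewrite ler_nat.
have [|a' ha'] := v_compl a.
  move=> M; exists (Num.bound `|M + M0|) => i j Ni Nj; rewrite -w_ext.
  apply: val_ge_le (a_near _ _ _ Ni Nj); rewrite lerBrDr.
  by apply: le_trans (ler_norm _) (ltW _); apply: archi_boundP.
exists a'; apply: IHs => M.
have [N hN] := ha' (M - fval w b).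
pose n := maxn N (Num.bound `|M|).
have [u su hu] := ha n; exists u => //.
have -> : x - phi a' * b - u =
    (x - phi (a n) * b - u) + phi (a n - a') * b by rewrite rmorphB; ring.
apply: val_geD => //.
  apply: val_ge_le hu; apply: (@le_trans _ _ (Num.bound `|M|)%:R).
    by apply: le_trans (ler_norm _) (ltW _); apply: archi_boundP.
  by rewrite ler_nat leq_maxr.
rewrite -[M](subrK (fval w b)); apply: val_geM => //; last exact: val_ge_val.
by rewrite /val_ge w_ext; apply: hN; rewrite leq_maxl.
Qed.

(** * Finitely spanned subalgebras of an algebraic extension *)

Definition subalgebra (E : L -> Prop) : Prop :=
  [/\ forall a, E (phi a), forall x y, E x -> E y -> E (x + y)
    & forall x y, E x -> E y -> E (x * y)].

Definition finitely_spanned (E : L -> Prop) : Prop :=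
  exists s, forall x, E x -> span s x.

Lemma subalgebraN E x : subalgebra E -> E x -> E (- x).
Proof. by case=> EK _ EM Ex; rewrite -mulN1r -(rmorphN1 phi); apply: EM. Qed.

Lemma subalgebra_sum E I (r : seq I) (F : I -> L) :
  subalgebra E -> (forall i, E (F i)) -> E (\sum_(i <- r) F i).
Proof.
case=> EK ED _ EF; apply: big_ind => //.
by rewrite -(rmorph0 phi); apply: EK.
Qed.

Lemma subalgebraX E x n : subalgebra E -> E x -> E (x ^+ n).
Proof.
case=> EK _ EM Ex; elim: n => [|n IHn].
  by rewrite expr0 -(rmorph1 phi); apply: EK.
by rewrite exprS; apply: EM.
Qed.

Lemma subalgebra_horner E (q : {poly K}) x :
  subalgebra E -> E x -> E (map_poly phi q).[x].
Proof.
move=> sE Ex; have [EK _ EM] := sE.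
rewrite horner_coef; apply: subalgebra_sum => // i.
by rewrite coef_map; apply: EM; [apply: EK | apply: subalgebraX].
Qed.

(** A relation [p(x) = 0] with nonzero constant term expresses the inverse as a polynomial in [x];
    factors [X] of [p] are cancelled first. *)
Lemma subalgebraV E x : subalgebra E -> E x -> algebraicOver phi x -> E x^-1.
Proof.
move=> sE Ex [p]; have [EK _ EM] := sE.
have [->|x0] := eqVneq x 0.
  by rewrite invr0 -(rmorph0 phi) => *; apply: EK.
elim/poly_ind: p => [|p c IHp]; first by rewrite eqxx.
rewrite /root rmorphD rmorphM /= map_polyX map_polyC /= !hornerE => pc0.
have [c0|c0] := eqVneq c 0.
  rewrite c0 rmorph0 addr0 mulf_eq0 (negPf x0) orbF; apply: IHp.
  by apply: contraNneq pc0 => ->; rewrite c0 mul0r addr0.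
move=> /eqP px.
have -> : x^-1 = phi (- c^-1) * (map_poly phi p).[x].
  apply: (mulIf x0); rewrite mulVf // -mulrA.
  move/eqP: px; rewrite addr_eq0 => /eqP ->.
  by rewrite -rmorphN -rmorphM mulrNN mulVf // rmorph1.
by apply: EM => //; apply: subalgebra_horner.
Qed.

(** The relation [p(x) = 0], divided by its leading coefficient, reduces powers of exponent at least
    [d] to smaller ones. *)
Lemma span_mul_powers s x (p : {poly K}) b n :
    p != 0 -> root (map_poly phi p) x -> b \in s ->
  span [seq y * x ^+ i | y <- s, i <- iota 0 (size p).-1] (b * x ^+ n).
Proof.
move=> p0 px bs; set d := (size p).-1; set t := [seq _ | _ <- _, _ <- _].
elim/ltn_ind: n => n IHn.
have [nd|dn] := ltnP n d.
  by apply: span_mem; apply/allpairsP; exists (b, n); rewrite mem_iota.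
have lp0 : p`_d != 0 by rewrite -[_`_d]/(lead_coef p) lead_coef_eq0.
have -> : b * x ^+ n =
    phi (- (p`_d)^-1) * \sum_(i < d) phi p`_i * (b * x ^+ (n - d + i)).
  have pE : \sum_(i < d.+1) phi p`_i * x ^+ i = 0.
    move/eqP: px; rewrite horner_coef size_map_poly => px; rewrite -[RHS]px.
    have -> : size p = d.+1 by rewrite prednK // size_poly_gt0.
    by apply: eq_bigr => i _; rewrite coef_map.
  have -> : \sum_(i < d) phi p`_i * (b * x ^+ (n - d + i)) =
      b * x ^+ (n - d) * \sum_(i < d) phi p`_i * x ^+ i.
    by rewrite mulr_sumr; apply: eq_bigr => i _; rewrite exprD; ring.
  move: pE; rewrite big_ord_recr /= => /eqP; rewrite addr_eq0 => /eqP ->.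
  have lp0' : phi p`_d != 0 by rewrite fmorph_eq0.
  have {1}-> : n = (n - d + d)%N by rewrite subnK.
  by rewrite exprD rmorphN fmorphV; field.
apply: spanZ; elim/big_ind: _ => [|y z|i _]; [exact: span0 | exact: spanD |].
by apply: spanZ; apply: IHn; rewrite -{2}(subnK dn) ltn_add2l.
Qed.

(** The witness is [E[x]], the set of values at [x] of polynomials with coefficients in [E]. *)
Lemma subalgebra_adjoin E x :
    subalgebra E -> finitely_spanned E -> algebraicOver phi x ->
  exists E', [/\ subalgebra E', finitely_spanned E', E' x
               & forall y, E y -> E' y].
Proof.
move=> sE [s Es] [p p0 px]; have [EK ED EM] := sE.
have E0 : E 0 by rewrite -(rmorph0 phi).
have EC y : E y -> forall i, E (y%:P)`_i.
  by move=> Ey i; rewrite coefC; case: ifP.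
exists (fun y => exists2 q : {poly L}, (forall i, E q`_i) & y = q.[x]).
split.
- split=> [a|_ _ [q Eq ->] [r Er ->]|_ _ [q Eq ->] [r Er ->]].
  + by exists (phi a)%:P; [apply: EC | rewrite hornerC].
  + by exists (q + r) => [i|]; [rewrite coefD; apply: ED | rewrite hornerD].
  + exists (q * r) => [i|]; last by rewrite hornerM.
    by rewrite coefM; apply: subalgebra_sum => // j; apply: EM.
- exists [seq y * x ^+ i | y <- s, i <- iota 0 (size p).-1] => _ [q Eq ->].
  rewrite horner_coef; elim/big_ind: _ => [|y z|i _]; [exact: span0 | exact: spanD |].
  suff aux r (y : L) n : {subset r <= s} -> span r y ->
      span [seq y * x ^+ i | y <- s, i <- iota 0 (size p).-1] (y * x ^+ n).
    by apply: (aux s) => //; apply: Es.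
  elim: r y => [y _ ->|b r IHr y rs [a ya]]; first by rewrite mul0r; apply: span0.
  rewrite -[y](subrK (phi a * b)) mulrDl -mulrA; apply: spanD.
    by apply: IHr => // c cr; apply: rs; rewrite in_cons cr orbT.
  by apply: spanZ; apply: span_mul_powers => //; apply: rs; rewrite mem_head.
- exists 'X; last by rewrite hornerX.
  by move=> i; rewrite coefX; case: eqP => // _; rewrite -(rmorph1 phi); apply: EK.
- by move=> y Ey; exists y%:P; [apply: EC | rewrite hornerC].
Qed.

Lemma finite_subalgebra (s : seq L) : (forall x, algebraicOver phi x) ->
  exists E, [/\ subalgebra E, finitely_spanned E & forall x, x \in s -> E x].
Proof.
move=> alg; elim: s => [|x s [E [sE fE Es]]].
  exists (fun y => exists a, y = phi a); split=> //.
    split=> [a|_ _ [a ->] [b ->]|_ _ [a ->] [b ->]]; first by exists a.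
      by exists (a + b); rewrite rmorphD.
    by exists (a * b); rewrite rmorphM.
  by exists [:: 1] => _ [a ->]; exists a; rewrite /= mulr1 subrr.
have [E' [sE' fE' E'x EE']] := subalgebra_adjoin sE fE (alg x).
exists E'; split=> // y; rewrite in_cons => /orP[/eqP -> //|/Es]; exact: EE'.
Qed.

(** With generators chosen inside [E], a limit of [E] lies in their span, hence in [E]. *)
Lemma subalgebra_closed (v : K -> \bar rat) (w : L -> \bar rat) E x :
    valuation w -> (forall a, w (phi a) = v a) -> valuation_complete v ->
    subalgebra E -> finitely_spanned E ->
  (forall M, exists2 y, E y & val_ge w M (x - y)) -> E x.
Proof.
move=> w_val w_ext v_compl [EK ED EM] [s Es] hx.
have [t [tE Et]] := finite_span_sub Es.
have : span t x.
  apply: (span_closed w_val w_ext v_compl) => M.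
  by have [y /Et yt] := hx M; exists y.
elim: t x tE {Et hx} => [x _ ->|b t IHt x tE [a /IHt xa]].
  by rewrite -(rmorph0 phi); apply: EK.
rewrite -[x](subrK (phi a * b)); apply: ED.
  by apply: xa => c ct; apply: tE; rewrite in_cons ct orbT.
by apply: EM => //; apply: tE; rewrite mem_head.
Qed.

End Span.

(** * Roots of [X^n - a] and finiteness of bounded levels of the backward orbit *)

Lemma closed_field_XnsubC (L : closedFieldType) n (a : L) : (0 < n)%N ->
  exists2 r : seq L, r != [::] & 'X^n - a%:P = \prod_(z <- r) ('X - z%:P).
Proof.
move=> n0; have [r] := closed_field_poly_normal ('X^n - a%:P).
rewrite lead_coefXnsubC // scale1r => rE; exists r => //.
apply/eqP => r0; have /eqP := size_XnsubC a n0.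
by rewrite rE r0 big_nil size_poly1 eqSS eq_sym eqn0Ngt n0.
Qed.

Lemma backward_orbit_finite (L : closedFieldType) n (c a : L) m : (0 < n)%N ->
  exists r : seq L, forall k u, (k <= m)%N ->
    iter k (horner ('X^n - c%:P)) u = a -> u \in r.
Proof.
move=> n0; elim: m => [|m [r hr]].
  by exists [:: a] => k u; rewrite leqn0 => /eqP -> /= ->; rewrite mem_head.
have [g hg] : exists g : L -> seq L, forall x u, ('X^n - c%:P).[u] = x -> u \in g x.
  suff /choice[g hg] (x : L) : exists s : seq L, forall u, ('X^n - c%:P).[u] = x -> u \in s.
    by exists g.
  have [s _ sE] := closed_field_XnsubC (c + x) n0; exists s => u.
  rewrite -root_prod_XsubC -sE /root !hornerE => <-.
  by rewrite [c + _]addrC subrK subrr.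
exists (a :: flatten [seq g x | x <- r]) => -[|k] u; first by move=> _ /= ->; rewrite mem_head.
rewrite ltnS iterSr => km /(hr _ _ km) ur.
rewrite in_cons; apply/orP; right; apply/flattenP; exists (g ('X^n - c%:P).[u]).
  exact: map_f.
exact: hg.
Qed.

(** * Dynamics of [z^l - c] when [delta] is positive *)

Section Dynamics.

Variables (L : closedFieldType) (v : L -> \bar rat).
Hypothesis v_valuation : valuation v.
Variables (l : nat) (c : L).
Hypotheses (l_ge2 : (2 <= l)%N) (l_neq0 : l%:R != 0 :> L) (c_neq0 : c != 0).

Local Notation F := (horner ('X^l - c%:P)).

(* [- s] is the valuation of the [l]-th roots of [c]; far enough in the backward
   orbit of any point, every element has this valuation. *)
Let s : rat := - fval v c / l%:R.
Let lam : rat := fval v l%:R.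
(* [- delta] is the valuation of [F'] at the elements of valuation [- s]. *)
Let delta : rat := s *+ l.-1 - lam.
Hypothesis delta_gt0 : 0 < delta.

Let on_circle (u : L) : Prop := u != 0 /\ fval v u = - s.

Let l_gt0 : (0 < l)%N. Proof. exact: leq_trans l_ge2. Qed.

Lemma lam_ge0 : 0 <= lam.
Proof. by rewrite -val_geP //; apply: val_ge_nat. Qed.

Lemma s_gt0 : 0 < s.
Proof.
have := lam_ge0; have := delta_gt0; rewrite /delta => d0 l0.
have : 0 < s *+ l.-1 by lra.
by rewrite pmulrn_lgt0 // -subn1 subn_gt0.
Qed.

Lemma fval_c : fval v c = - (s *+ l).
Proof.
by rewrite -[s *+ l]mulr_natr /s mulfVK ?opprK // pnatr_eq0 -lt0n.
Qed.

Lemma F_E u : F u = u ^+ l - c.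
Proof. by rewrite !hornerE. Qed.

Lemma s_mulrn : s *+ l = s + s *+ l.-1.
Proof. by rewrite -mulrS prednK. Qed.

Lemma fval_deriv u : on_circle u ->
  u ^+ l.-1 *+ l != 0 /\ fval v (u ^+ l.-1 *+ l) = - delta.
Proof.
move=> [u0 us]; rewrite -mulr_natr; split; first by rewrite mulf_neq0 // expf_neq0.
by rewrite fvalM ?expf_neq0 // fvalX // us /delta mulNrn opprB addrC.
Qed.

(** [F - y] splits into linear factors, so [val_ge_deriv_prod] gives a root [z] with
    [v(F u - y) - v(u - z)] at most [- delta], the valuation of the derivative at [u]. *)
Lemma F_expanding q u y : on_circle u -> val_ge v q (F u - y) ->
  exists2 z, F z = y & val_ge v (q + delta) (u - z).
Proof.
move=> cu; have [d0 dE] := fval_deriv cu.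
have [r r0 rE] := closed_field_XnsubC (c + y) l_gt0.
have PE z : ('X^l - (c + y)%:P).[z] = F z - y.
  by rewrite F_E !hornerE; ring.
(* If [F u = y], then [u] is the preimage sought; [fval] would be meaningless at [F u - y]. *)
have [Fu|Fu] := eqVneq (F u) y.
  by move=> _; exists u => //; rewrite subrr; apply: val_ge0.
have Fuy : F u - y != 0 by rewrite subr_eq0.
have ur z : z \in r -> u != z.
  move=> zr; apply: contraNneq Fuy => ->.
  by rewrite -PE rE; rewrite -root_prod_XsubC in zr.
have /= [z zr] := val_ge_deriv_prod v_valuation r0 ur.
rewrite -rE PE derivB derivXn derivC subr0 hornerMn hornerXn.
rewrite val_geP // dE => hz hq; exists z.
  by apply/eqP; rewrite -subr_eq0 -PE rE; rewrite -root_prod_XsubC in zr.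
move: hq; rewrite !val_geP // ?subr_eq0 ?ur //; lra.
Qed.

(** As [l >= 2], taking an [l]-th root of [F u + c] halves the defect [a]. *)
Lemma preimage_bound a u : 0 <= a -> val_ge v (- s - a) (F u) ->
  val_ge v (- s - a / 2) u.
Proof.
move=> a0; have [->|u0] := eqVneq u 0; first by move=> _; apply: val_ge0.
have s0 := s_gt0.
have l2 : (s + a / 2) *+ 2 <= (s + a / 2) *+ l by rewrite ler_wpMn2l //; lra.
rewrite F_E => hu.
have : val_ge v (- ((s + a / 2) *+ l)) (u ^+ l - c + c).
  apply: val_geD => //.
    by apply: val_ge_le hu; lra.
  by rewrite val_geP // fval_c lerN2 lerMn2r; apply/orP; right; lra.
rewrite subrK !val_geP ?expf_neq0 // fvalX // -mulNrn lerMn2r.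
by rewrite eqn0Ngt l_gt0 /=; lra.
Qed.

(** Here [c] dominates in [u ^+ l = F u + c]. *)
Lemma preimage_on_circle q u : val_ge v q (F u) -> - (s *+ l) < q -> on_circle u.
Proof.
rewrite F_E -fval_c => hu /(val_add_eq v_valuation c_neq0 hu).
rewrite addrC subrK => -[ul0 ulE].
have u0 : u != 0 by apply: contraNneq ul0 => ->; rewrite expr0n eqn0Ngt l_gt0.
split=> //; move: ulE; rewrite fvalX // fval_c -mulNrn => /eqP.
by rewrite eqrMn2r eqn0Ngt l_gt0 => /eqP.
Qed.

(** The defect [A] is halved at each level until it falls below [s *+ l.-1]; then [c] dominates. *)
Lemma backward_orbit_on_circle x :
  exists N, forall n u, (N <= n)%N -> iter n F u = x -> on_circle u.
Proof.
pose A := `|fval v x + s|.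
have A0 : 0 <= A by apply: normr_ge0.
have xA : val_ge v (- s - A) x.
  apply: val_ge_le (val_ge_val v_valuation x).
  have := lerNnormlW (lexx A); lra.
have bound n u : iter n F u = x -> val_ge v (- s - A / 2 ^+ n) u.
  elim: n u => [u /= ->|n IHn u]; first by rewrite expr0 divr1.
  rewrite iterSr => /IHn /preimage_bound.
  by rewrite exprSr invfM mulrA; apply; rewrite divr_ge0 // exprn_ge0.
have s0 : 0 < s *+ l.-1 by have := lam_ge0; have := delta_gt0; rewrite /delta; lra.
(* The bound gives [A / 2 ^+ n < s *+ l.-1] because [m < 2^m]; the successor counts the last
   preimage, taken by [preimage_on_circle]. *)
exists (Num.bound (A / (s *+ l.-1))).+1 => -[//|n] u Nn; rewrite iterSr => /bound hu.
apply: preimage_on_circle hu _; rewrite s_mulrn opprD ltrD2l ltrN2.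
rewrite ltr_pdivrMr ?exprn_gt0 // mulrC -ltr_pdivrMr //.
have /archi_boundP lt_A : 0 <= A / (s *+ l.-1) by rewrite divr_ge0 // ltW.
apply: lt_trans lt_A _; rewrite -natrX ltr_nat.
by rewrite ltnS in Nn; apply: leq_ltn_trans Nn (ltn_expl _ _).
Qed.

(** [F_expanding] is applied along the orbit of [u], from its end back to [u]; each pull-back gains
    [delta]. *)
Lemma backward_orbit_shadowing k q u y :
    (forall j, (j < k)%N -> on_circle (iter j F u)) ->
    val_ge v q (iter k F u - y) ->
  exists2 z, iter k F z = y & val_ge v (q + delta *+ k) (u - z).
Proof.
elim: k u => [|k IHk] u cu; first by exists y => //; rewrite addr0.
rewrite iterSr => /IHk[j jk|z zE hz]; first by rewrite -iterSr; apply: cu.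
have [z' z'E hz'] := F_expanding (cu 0%N isT) hz.
exists z'; first by rewrite iterSr z'E.
by rewrite mulrSr addrA.
Qed.

(** Up to sign, the new error is the second-order Taylor remainder divided by the derivative: the
    remainder doubles [t], the division costs [lam]. *)
Lemma Newton_step t b x : 0 <= t -> on_circle x -> val_ge v (- s + t) (b - x) ->
  val_ge v (- s + (t *+ 2 - lam))
    (b - (x + (b ^+ l - x ^+ l) / (x ^+ l.-1 *+ l))).
Proof.
move=> t0 cx hbx; have [d0 dE] := fval_deriv cx; have [x0 xE] := cx.
have xs : val_ge v (- s) x by rewrite val_geP // xE.
have := val_ge_Taylor2 v_valuation l t0 xs hbx.
rewrite [x + (b - x)]addrC subrK => hT.
have -> : b - (x + (b ^+ l - x ^+ l) / (x ^+ l.-1 *+ l)) =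
    - ((b ^+ l - x ^+ l - x ^+ l.-1 * (b - x) *+ l) * (x ^+ l.-1 *+ l)^-1).
  by rewrite -mulrnAl; move: (x ^+ l.-1 *+ l) d0 => D d0; field.
have -> : - s + (t *+ 2 - lam) = - s *+ l + t *+ 2 + delta.
  by rewrite /delta mulNrn s_mulrn; ring.
apply: val_geN => //; apply: val_geM => //.
by rewrite val_geP ?invr_eq0 // fvalV // dE opprK.
Qed.

(** Newton's iteration involves [b] only through [b ^+ l], so the iterates stay in [E], which is
    closed. *)
Lemma Newton_root (K : fieldType) (phi : {rmorphism K -> L}) (w : K -> \bar rat)
    (E : L -> Prop) t b x :
    (forall a, v (phi a) = w a) -> valuation_complete w ->
    (forall y, algebraicOver phi y) -> subalgebra phi E -> finitely_spanned phi E ->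
    on_circle b -> E (b ^+ l) -> lam < t -> E x -> val_ge v (- s + t) (b - x) ->
  E b.
Proof.
move=> w_ext w_compl alg sE fE [b0 bs] Ebl lt_t Ex hx.
have [EK ED EM] := sE; have l0 := lam_ge0.
have circle y r : 0 < r -> val_ge v (- s + r) (b - y) -> on_circle y.
  move=> r0 /(val_geN v_valuation); rewrite opprB => hy.
  have [|y0 yE] := val_add_eq v_valuation b0 hy; first by rewrite bs; lra.
  by rewrite addrC subrK in y0 yE; rewrite /on_circle yE.
pose eps := t - lam; have eps0 : 0 < eps by rewrite /eps; lra.
(* A Newton step doubles the excess over [lam]; recording only a gain of [eps] per step is enough
   for convergence. *)
have approx n : exists2 y, E y & val_ge v (- s + (lam + eps *+ n.+1)) (b - y).
  elim: n => [|n [y Ey hy]].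
    by exists x => //; rewrite mulr1n /eps [lam + _]addrC subrK.
  have en0 : 0 < eps *+ n.+1 by rewrite pmulrn_lgt0.
  have cy : on_circle y by apply: circle hy; lra.
  have Ey' m : E (y ^+ m) by apply: subalgebraX.
  exists (y + (b ^+ l - y ^+ l) / (y ^+ l.-1 *+ l)).
    apply: (ED) => //; apply: (EM).
      by apply: ED => //; apply: (subalgebraN sE).
    apply: (subalgebraV sE) => //; rewrite -mulr_natr; apply: EM => //.
    by rewrite -(rmorph_nat phi).
  have t0 : 0 <= lam + eps *+ n.+1 by lra.
  apply: val_ge_le (Newton_step t0 cy hy).
  have : eps <= eps *+ n.+1 by rewrite -{1}[eps]mulr1n ler_wpMn2l // ltW.
  rewrite [eps *+ n.+2]mulrS; lra.
apply: (subalgebra_closed v_valuation w_ext w_compl sE fE) => M.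
have [y Ey hy] := approx (Num.bound (`|M + s| / eps)).
exists y => //; apply: val_ge_le hy.
have /archi_boundP : 0 <= `|M + s| / eps by rewrite divr_ge0 // ltW.
rewrite ltr_pdivrMr // mulr_natl => lt_M.
rewrite mulrS; have := ler_norm (M + s); lra.
Qed.

(** [E] contains [c] and all levels up to [N + k]; strong induction on the level places all later
    ones in [E]. *)
Lemma backward_orbit_in_subalgebra (K : fieldType) (phi : {rmorphism K -> L})
    (w : K -> \bar rat) (x : L) :
    (forall a, v (phi a) = w a) -> valuation_complete w ->
    (forall y, algebraicOver phi y) ->
  exists E, [/\ subalgebra phi E, finitely_spanned phi E
              & forall n u, iter n F u = x -> E u].
Proof.
move=> w_ext w_compl alg.
have [N circle] := backward_orbit_on_circle x.
(* After [k] pull-backs the gain exceeds [lam], the threshold of [Newton_root]. *)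
pose k := Num.bound (lam / delta).
have lam_k : lam < delta *+ k.
  have /archi_boundP : 0 <= lam / delta by rewrite divr_ge0 ?lam_ge0 // ltW.
  by rewrite ltr_pdivrMr // mulr_natl.
have [r hr] := backward_orbit_finite c x (N + k) l_gt0.
have [E [sE fE Er]] := finite_subalgebra (c :: r) alg.
exists E; split=> //; elim/ltn_ind => n IHn u un.
have [nM|Mn] := leqP n (N + k).
  by apply: Er; rewrite in_cons (hr n) ?orbT.
have nE : n = (N + (n - N.+1).+1)%N by lia.
set k' := (n - N.+1)%N in nE.
have EFu : E (F u).
  by apply: (IHn n.-1); [lia | rewrite -iterSr prednK //; lia].
have cu j : (j <= k'.+1)%N -> on_circle (iter j F u).
  move=> jk; apply: (circle (n - j)%N); first by lia.
  by rewrite -iterD subnK //; lia.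
(* These points lie at levels [N + 1] and [N], both on the circle. Pulling the second back [k']
   times towards [u] yields [z] at level [n - 1], already in [E]. *)
have hq : val_ge v (- s) (iter k' F u - iter k'.+1 F u).
  apply: val_geB => //.
    by have [y0 ys] := cu k' (leqnSn _); rewrite val_geP // ys.
  by have [y0 ys] := cu k'.+1 (leqnn _); rewrite val_geP // ys.
have [|z zE hz] := backward_orbit_shadowing _ hq.
  by move=> j jk; apply: cu; lia.
have Ez : E z.
  apply: (IHn (N + k')%N); first by lia.
  by rewrite iterD zE -iterD -nE.
have [_ ED _] := sE.
apply: (Newton_root w_ext w_compl alg sE fE (cu 0%N isT) _ _ Ez hz).
  by rewrite /= -[u ^+ l](subrK c) -F_E; apply: ED => //; apply: Er; rewrite mem_head.
by apply: lt_le_trans lam_k _; rewrite ler_wpMn2l ?ltW //; lia.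
Qed.

End Dynamics.

Theorem theorem5p3
    (K : fieldType) (v : K -> \bar rat) (p : nat)
    (v_discrete : discrete_valuation v)
    (v_complete : valuation_complete v)
    (v_residue : residue_characteristic v p)
    (v_normalized : v p%:R = 1%E)
    (Kbar : closedFieldType) (iota : {rmorphism K -> Kbar})
    (iota_algebraic : forall x : Kbar, algebraicOver iota x)
    (vbar : Kbar -> \bar rat)
    (vbar_valuation : valuation vbar)
    (vbar_extends : forall x : K, vbar (iota x) = v x)
    (l : nat) (l_ge2 : (2 <= l)%N)
    (c : Kbar) (f_separable : separable_poly ('X^l - c%:P))
    (alpha : K) :
  (vbar c < nu_infty v l)%E ->
  finite_extension iota (preimage_field_infty iota ('X^l - c%:P) alpha).
Proof.
have l_gt0 : (0 < l)%N by apply: ltnW.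
(* If [l] vanished in [Kbar], the derivative of [f] would be 0, which is not coprime to a
   nonconstant polynomial. *)
have l0 : l%:R != 0 :> Kbar.
  apply: contraL f_separable => /eqP l0.
  rewrite separable_poly.unlock derivB derivXn derivC subr0 -mulr_natr -polyC_natr l0.
  by rewrite mulr0 coprimep0 -size_poly_eq1 size_XnsubC // eqSS -lt0n.
rewrite /nu_infty -vbar_extends rmorph_nat (fvalE vbar_valuation l0).
move=> lt_c.
have c0 : c != 0.
  apply: contraTneq lt_c => ->; case: vbar_valuation => _ v0 _ _.
  by rewrite ((v0 0).2 erefl) -leNgt leey.
rewrite (fvalE vbar_valuation c0) -EFinM lte_fin in lt_c.
(* This is the hypothesis on [v(c)] rescaled by [(l - 1) / l]. *)
have delta_gt0 : 0 < (- fval vbar c / l%:R) *+ l.-1 - fval vbar l%:R.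
  have l1 : 0 < l.-1%:R :> rat by rewrite ltr0n -subn1 subn_gt0.
  have lE : l%:R = l.-1%:R + 1 :> rat by rewrite natr1 prednK.
  move: lt_c; rewrite lE addrK -[_ / _ *+ l.-1]mulr_natr.
  have l2 : 0 < l.-1%:R + 1 :> rat by lra.
  move: (fval vbar c) (fval vbar l%:R) (l.-1%:R : rat) l1 l2 => x y m m0 m1 lt_x.
  have -> : - x / (m + 1) * m - y = (- ((m + 1) / m) * y - x) * (m / (m + 1)).
    by field; rewrite !gt_eqF.
  by rewrite mulr_gt0 ?subr_gt0 // divr_gt0.
have [E [sE [s Es] orbitE]] := backward_orbit_in_subalgebra vbar_valuation
  l_ge2 l0 c0 delta_gt0 (iota alpha) vbar_extends v_complete iota_algebraic.
have [EK ED EM] := sE.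
(* Algebraicity makes [E] a subfield, so it contains each [K_n] by minimality. *)
have fieldE : divring_closed (mem (E : set Kbar)).
  split=> [|x y|x y]; rewrite !in_setE; first by rewrite -(rmorph1 iota); apply: EK.
    by move=> Ex Ey; apply: ED => //; apply: (subalgebraN sE).
  by move=> Ex Ey; apply: EM => //; apply: (subalgebraV sE).
have subE x : preimage_field_infty iota ('X^l - c%:P) alpha x -> E x.
  case=> n _; apply: smallest_sub => // y [[a _ <-]|]; first exact: EK.
  exact: orbitE.
(* The generators must lie in the union of the [K_n] itself, not just in [E]. *)
have [t [tS St]] := finite_span_sub (fun x Sx => Es x (subE x Sx)).
exists (size t), (fun i => t`_i); split=> [i|x /St]; last exact: span_sumE.
by apply: tS; apply: mem_nth.
Qed.
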